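(* Let $(X,f)$ be a purely attracting Cantor system. Then there exist a sequence of finite clopen partitions $(\mathcal{U}_n)_{n\ge 1}$ of $X$ such that $\lim_{n\to\infty}\operatorname{mesh}(\mathcal{U}_n)=0$ and such that for all $n\ge 1$ and all $u\in\mathcal{U}_n$, $u=\mathcal{E}(\{v\in\mathcal{U}_{n+1}: v\subset u\})$, a sequence of functions $\chi_n\colon\mathcal{U}_n\to\{\downarrow,0,*,\uparrow\}$, and a non-decreasing sequence of integers $\tau_n\ge n$, such that for all $n\ge 1$, $(\mathcal{U}_n,\tau_n,\chi_n)$ is a well-marked partition and $(\mathcal{U}_{n+1},\tau_{n+1},\chi_{n+1})$ is well-marked relatively to $(\mathcal{U}_n,\tau_n,\chi_n)$. Moreover, for all $n\ge 1$, every divergent vertex of $G(\mathcal{U}_n)$ is a marker of $(\mathcal{U}_n,\tau_n,\chi_n)$.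
   Context: A Cantor system is a pair $(X,f)$ with $X$ a Cantor set (zero-dimensional compact metric space without isolated points) and $f\colon X\to X$ continuous. Partitions have nonempty elements. For a set $\mathcal{U}$ of subsets of $X$, $\mathcal{E}(\mathcal{U})$ denotes the union of its elements; $\operatorname{mesh}(\mathcal{U})$ is the maximal diameter of its elements. $\mathcal{V}\prec\mathcal{U}$ ($\mathcal{V}$ refines $\mathcal{U}$) means every $v\in\mathcal{V}$ is contained in some $u\in\mathcal{U}$, denoted $\pi_{\mathcal{U}}^{\mathcal{V}}(v)$. Finite orbits are periodic orbits; $|p|$ is the cardinality of $p$. A set $u\subset X$ is stable if $f(u)\subset u$. A stable clopen set $u\supset p$ is attracted by the finite orbit $p$ if $\bigcap_{n\ge0}f^n(u)=p$; $p$ is attracting if such a $u$ exists. $(X,f)$ is purely attracting if all its finite orbits are attracting. For a finite clopen partition $\mathcal{U}$, $G(\mathcal{U})$ is the directed graph with vertex set $\mathcal{U}$ and edges the pairs $(u,v)\in\mathcal{U}^2$ such that $f(x)\in v$ for some $x\in u$. A circuit is a directed cycle which is minimal for inclusion (as a set of edges). A divergent vertex is a vertex with at least two outgoing edges. A supercyclical partition is a pair $(\mathcal{U},n)$, with $\mathcal{U}$ a finite clopen partition of $X$ and $n\ge1$ an integer, such that for every periodic orbit $p$ with $|p|\le n$ there is a subset ${}^p\mathcal{U}\subset\mathcal{U}$ such that $\mathcal{E}({}^p\mathcal{U})$ is stable, contains $p$ and is attracted by $p$. In that case, for each such $p$, ${}^p_*\mathcal{U}$ denotes the largest (for inclusion)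 subset of $\mathcal{U}$ whose union is attracted by $p$ (it exists). The attracted part of $(\mathcal{U},n)$ is $\bigcup_{|p|\le n}{}^p_*\mathcal{U}$, and its supercyclical part is the remainder of $\mathcal{U}$. A marked partition is a triple $(\mathcal{U},\tau,\chi)$ with $(\mathcal{U},\tau)$ a supercyclical partition and $\chi\colon\mathcal{U}\to\{\uparrow,*,0,\downarrow\}$. An element $u$ is a marker if $\chi(u)=*$ and a potential if $\chi(u)=\uparrow$. It is well-marked when: (1) $\chi(u)=0$ for all $u$ in the attracted part of $(\mathcal{U},\tau)$, and $\chi(u)\ne0$ for all other $u$; (2) every circuit of $G(\mathcal{U})$ whose vertices are all in the supercyclical part of $(\mathcal{U},\tau)$ contains at least one marker and one potential. For well-marked partitions $(\mathcal{U},\tau,\chi)$, $(\mathcal{V},\tau',\chi')$ with $\mathcal{V}\prec\mathcal{U}$, $(\mathcal{V},\tau',\chi')$ is well-marked relatively to $(\mathcal{U},\tau,\chi)$ when for all $u$ in the supercyclical part of $(\mathcal{V},\tau')$, the two-letter word $\chi'(u)\,\chi(\pi_{\mathcal{U}}^{\mathcal{V}}(u))$ belongs to $\{*\uparrow,\ \uparrow\uparrow,\ \downarrow\uparrow,\ \downarrow*,\ \downarrow\downarrow\}$. *)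

(* Defs.v *)
From HB Require Import structures.
From mathcomp Require Import all_boot all_order all_algebra.
From mathcomp Require Import all_classical all_reals all_analysis.

Set Implicit Arguments.
Unset Strict Implicit.
Unset Printing Implicit Defensive.

Import Order.TTheory GRing.Theory Num.Theory.

Local Open Scope classical_set_scope.
Local Open Scope card_scope.

Section digraph.
Context {V : choiceType}.
Implicit Types G C : set (V * V).

(* The edge set of a (possibly self-intersecting) closed walk of positive
   length: a sequence [:: v_1; ...; v_k] yields v_1 -> v_2 -> ... -> v_k -> v_1. *)
Definition directed_cycle G C :=
  exists c : seq V, [/\ c != [::], cycle (fun u v => `[< G (u, v) >]) c &
    C = [set` zip c (rot 1 c)]].

Definition circuit G C :=
  directed_cycle G C /\
  forall C', directed_cycle G C' -> C' `<=` C -> C' = C.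

(* On a directed cycle, every vertex is the source of an edge. *)
Definition cycle_vertices C : set V := fst @` C.

Definition divergent G (u : V) :=
  exists v w, [/\ G (u, v), G (u, w) & v <> w].

End digraph.

Section mesh.
Context {R : realType} {X : metricType R}.
Local Open Scope ring_scope.

(* Suprema in R: these are used on bounded sets only (X compact), and
   the supremum of the empty set is 0. *)
Definition diameter (A : set X) : R := sup [set mdist x y | x in A & y in A].

Definition mesh (U : set (set X)) : R := sup (diameter @` U).

End mesh.

Definition refines {T : Type} (V U : set (set T)) :=
  forall v, V v -> exists2 u, U u & v `<=` u.

(* The element of U containing v: it is unique when U is a partition and v is
   a nonempty set contained in some element of U. *)
Definition parent {T : Type} (U : set (set T)) (v : set T) : set T :=
  get [set u | U u /\ v `<=` u].

Definition union {T : Type} (U : set (set T)) : set T := cover U id.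

(* mup, mstar, mzero, mdown stand for the symbols ↑, *, 0, ↓ *)
Inductive mark := mup | mstar | mzero | mdown.

Section system.
Context {X : topologicalType} (f : X -> X).
Implicit Types (U V A : set (set X)) (p u : set X) (n : nat).
Implicit Type chi : set X -> mark.

Definition cantor_system := cantor_like X /\ continuous f.

Definition periodic_orbit p :=
  exists x k, [/\ (0 < k)%N, iter k f x = x & p = range (fun i => iter i f x)].

Definition stable u := f @` u `<=` u.

Definition attracted_by u p :=
  [/\ clopen u, stable u, p `<=` u & \bigcap_n (iter n f @` u) = p].

Definition attracting p := exists u, attracted_by u p.

Definition purely_attracting := forall p, periodic_orbit p -> attracting p.

Definition clopen_partition U :=
  [/\ finite_set U, partition U id [set: X] & U `<=` clopen].

Definition graph U : set (set X * set X) :=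
  [set e | [/\ U e.1, U e.2 & exists2 x, e.1 x & e.2 (f x)]].

Definition supercyclical U n :=
  [/\ clopen_partition U, (1 <= n)%N &
    forall p, periodic_orbit p -> p #<= `I_n ->
      exists2 A, A `<=` U & attracted_by (union A) p].

(* The largest subset of U whose union is attracted by p. *)
Definition basin U p : set (set X) :=
  get [set A | [/\ A `<=` U, attracted_by (union A) p &
    forall B, B `<=` U -> attracted_by (union B) p -> B `<=` A]].

Definition attracted_part U n : set (set X) :=
  \bigcup_(p in [set p | periodic_orbit p /\ p #<= `I_n]) basin U p.

Definition supercyclical_part U n : set (set X) := U `\` attracted_part U n.

(* A marking of U is given by a function on all subsets of X, of which only
   the values on the elements of U are relevant. *)
Definition marker U chi u := U u /\ chi u = mstar.

Definition potential U chi u := U u /\ chi u = mup.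

Definition well_marked U n chi :=
  [/\ supercyclical U n,
      forall u, attracted_part U n u -> chi u = mzero,
      forall u, supercyclical_part U n u -> chi u <> mzero &
      forall C, circuit (graph U) C ->
        cycle_vertices C `<=` supercyclical_part U n ->
        (exists2 u, cycle_vertices C u & marker U chi u) /\
        (exists2 u, cycle_vertices C u & potential U chi u)].

Definition admissible_word (a b : mark) : bool :=
  match a, b with
  | mstar, mup | mup, mup | mdown, mup | mdown, mstar | mdown, mdown => true
  | _, _ => false
  end.

(* (V, m, chi') is well-marked relatively to (U, n, chi). *)
Definition relatively_well_marked V m chi' U n chi :=
  [/\ well_marked V m chi', well_marked U n chi, refines V U &
    forall v, supercyclical_part V m v ->
      admissible_word (chi' v) (chi (parent U v))].

End system.

(* Main.v *)
(* A clopen partition is the set of fibres of a locally constant map, and a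
   marked partition is built from a clopen set P that meets every orbit which is
   not attracted by a periodic orbit of size at most n. Returns to P take a
   bounded time N; after absorbing all periodic orbits of size at most N + 1 in
   a stable clopen set A, the return map r of P has no fixed point outside A,
   hence a finite clopen colouring c of P satisfies c (r x) <> c x there. The
   new markers are the ascents M = {c x < c (r x)} and the new potentials the
   descents P' = {c (r x) < c x}: they are disjoint, and since a colour can
   neither increase nor decrease forever, every orbit meets each of them unless
   it enters A.
   Cutting a fine partition along itineraries up to the first visit to M makes
   the cells outside M non-divergent. The cells of M inside the attracted part
   must be non-divergent too: a second cut, up to the visits to M outside the
   attracted part of the first one, achieves this without enlarging it. Finally
   the hitting times of M and P' modulo A decrease along the edges of the graph,
   so that no circuit avoids M or P' in the supercyclical part. *)

Require Import Defs.
From HB Require Import structures.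
From mathcomp Require Import all_boot all_order all_algebra.
From mathcomp Require Import all_classical all_reals all_analysis.

Set Implicit Arguments.
Unset Strict Implicit.
Unset Printing Implicit Defensive.

Import Order.TTheory GRing.Theory Num.Theory.
Import numFieldNormedType.Exports.

Local Open Scope classical_set_scope.

(** * Locally constant maps, their fibres, and the filter of refinements *)

Section locally_constant.
Context {X : topologicalType}.

(** The codomain carries no topology and may be [Prop]: clopen sets are then locally constant maps
    too ([clopen_loc_const]), and [finer h A] says that [A] is a union of fibres. *)
Definition loc_const {T : Type} (h : X -> T) :=
  forall x, \forall y \near x, h y = h x.

Definition finer {S T : Type} (g : X -> S) (h : X -> T) :=
  forall x y, g x = g y -> h x = h y.

Definition saturated {T : Type} (h : X -> T) (A : set X) :=
  forall x y, h x = h y -> A x -> A y.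

Definition fibre {T : Type} (h : X -> T) (x : X) : set X :=
  [set y | h y = h x].

Lemma finer_trans {S T U : Type} (g : X -> S) (h : X -> T) (k : X -> U) :
  finer g h -> finer h k -> finer g k.
Proof. by move=> gh hk x y /gh /hk. Qed.

Lemma saturated_finer {T : Type} (h : X -> T) (A : set X) :
  saturated h A <-> finer h A.
Proof.
split=> [hA x y hxy|hA x y /hA ->//].
by apply/propext; split; apply: hA.
Qed.

Lemma finer_saturated {S T : Type} (g : X -> S) (h : X -> T) (A : set X) :
  finer g h -> saturated h A -> saturated g A.
Proof. by move=> gh hA x y /gh; exact: hA. Qed.

Lemma saturatedU {T : Type} (h : X -> T) (A B : set X) :
  saturated h A -> saturated h B -> saturated h (A `|` B).
Proof.
by move=> hA hB x y hxy [/(hA _ _ hxy)|/(hB _ _ hxy)]; [left|right].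
Qed.

Lemma saturatedC {T : Type} (h : X -> T) (A : set X) :
  saturated h A -> saturated h (~` A).
Proof. by move=> hA x y hxy nAx /(hA _ _ (esym hxy)). Qed.

Lemma saturatedI {T : Type} (h : X -> T) (A B : set X) :
  saturated h A -> saturated h B -> saturated h (A `&` B).
Proof.
by move=> hA hB x y hxy [Ax Bx]; split; [exact: hA hxy Ax|exact: hB hxy Bx].
Qed.

Lemma fibreE {T : Type} (h : X -> T) (x y : X) :
  (fibre h x = fibre h y) <-> (h x = h y).
Proof.
split=> [e|e]; last by rewrite /fibre e.
by have : fibre h x x by []; rewrite e.
Qed.

Lemma fibre_finer {T : Type} (h : X -> T) : finer (fibre h) h.
Proof. by move=> x y /fibreE. Qed.

Lemma loc_const_finer {S T : Type} (g : X -> S) (h : X -> T) :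
  finer g h -> loc_const g -> loc_const h.
Proof. by move=> gh lg x; near=> y; apply: gh; near: y; exact: lg.
Unshelve. all: by end_near. Qed.

Lemma loc_const_fibre {T : Type} (h : X -> T) :
  loc_const h -> loc_const (fibre h).
Proof. by apply: loc_const_finer => x y /fibreE. Qed.

Lemma loc_const_pair {S T : Type} (g : X -> S) (h : X -> T) :
  loc_const g -> loc_const h -> loc_const (fun x => (g x, h x)).
Proof.
move=> lg lh x; near=> y; congr pair; near: y; [exact: lg|exact: lh].
Unshelve. all: by end_near. Qed.

Lemma loc_constU (A B : set X) :
  loc_const A -> loc_const B -> loc_const (A `|` B).
Proof.
move=> lA lB; apply: loc_const_finer (loc_const_pair lA lB) => x y [Axy Bxy].
by rewrite /setU /= Axy Bxy.
Qed.

Lemma loc_const_comp {T : Type} (h : X -> T) (k : X -> X) :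
  loc_const h -> continuous k -> loc_const (h \o k).
Proof. by move=> lh ck x; exact: (ck x _ (lh (k x))). Qed.

Lemma near_ltn {T : Type} (F : set_system T) {FF : Filter F} (n : nat)
    (P : nat -> T -> Prop) :
  (forall i, (i < n)%N -> \forall y \near F, P i y) ->
  \forall y \near F, forall i, (i < n)%N -> P i y.
Proof.
elim: n => [|n IHn] nP; first by apply: nearW.
near=> y => i; rewrite ltnS leq_eqVlt => /orP[/eqP->|]; last first.
  by move: i; near: y; apply: IHn => i /ltnW; exact: nP.
by near: y; exact: nP.
Unshelve. all: by end_near. Qed.

Lemma clopen_loc_const (A : set X) : clopen A <-> loc_const A.
Proof.
split=> [[oA cA] x|lA].
  have [Ax|nAx] := pselect (A x).
    near=> y; apply/propext; split=> // _; near: y.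
    exact: open_nbhs_nbhs.
  near=> y; apply/propext; split=> // Ay; exfalso; move: Ay.
  near: y; apply: open_nbhs_nbhs; split=> //; exact: closed_openC.
split.
  rewrite openE => x Ax; rewrite /interior /=.
  by near=> y; have -> : A y = A x by near: y; exact: lA.
rewrite -openC openE => x nAx; rewrite /interior /=.
by near=> y; have -> : (~` A) y = (~` A) x
  by rewrite /setC /=; congr (~ _); near: y; exact: lA.
Unshelve. all: by end_near. Qed.

Lemma saturated_clopen {T : Type} (h : X -> T) (A : set X) :
  loc_const h -> saturated h A -> clopen A.
Proof.
move=> lh /saturated_finer hA; apply/clopen_loc_const.
exact: loc_const_finer lh.
Qed.

(* Events that hold eventually under refinement. The codomain set X is no
   restriction, because fibre h has the same fibres as h. *)
Definition fine_maps : set_system (X -> set X) :=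
  [set S | exists h : X -> set X, loc_const h /\
    forall g : X -> set X, loc_const g -> finer g h -> S g].

Global Instance fine_maps_filter : Filter fine_maps.
Proof.
split.
- by exists (fun=> set0); split=> // x; apply: nearW.
- move=> P Q [h [lh hP]] [k [lk kQ]].
  exists (fibre (fun x => (h x, k x))); split.
    exact/loc_const_fibre/loc_const_pair.
  move=> g lg /finer_trans /(_ (fibre_finer (h := _))) ghk; split.
    by apply: hP => // x y /ghk [].
  by apply: kQ => // x y /ghk [].
- by move=> P Q PQ [h [lh hP]]; exists h; split=> // g lg /hP /PQ; apply.
Qed.

Lemma fine_maps_ex (S : set (X -> set X)) :
  fine_maps S -> exists2 h, loc_const h & S h.
Proof. by move=> [h [lh hS]]; exists h => //; exact: hS. Qed.

Lemma fine_maps_finer {T : Type} (h : X -> T) :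
  loc_const h -> \forall g \near fine_maps, finer g h.
Proof.
move=> lh; exists (fibre h); split; first exact: loc_const_fibre.
by move=> g lg gh; apply: finer_trans gh _; exact: fibre_finer.
Qed.

(** Turns local statements into uniform ones. It serves with [F] the filter at infinity, for uniform
    times, and with [fine_maps], for a single partition that works everywhere. *)
Lemma near_compact {I : Type} (F : set_system I) {FF : Filter F}
    (P : I -> X -> Prop) : compact [set: X] ->
  (forall x : X, \forall x' \near x & i \near F, P i x') ->
  \forall i \near F, forall x, P i x.
Proof.
move=> /compact_near_coveringP cX xP.
have := cX I F P FF (fun x _ => xP x).
by apply: filterS => i iP x; exact: iP.
Qed.

End locally_constant.

(** * Attraction by periodic orbits *)

Section attraction.
Context {X : topologicalType} (f : X -> X).
Hypotheses (cX : compact [set: X]) (hX : hausdorff_space X) (cf : continuous f).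
Implicit Types (p q u a b : set X).

Lemma iter_continuous n : continuous (iter n f).
Proof.
elim: n => [|n IHn] x; first exact: cvg_id.
by apply: continuous_comp; [exact: IHn|exact: cf].
Qed.

Lemma stable_iter u : stable f u -> forall k x, u x -> u (iter k f x).
Proof.
by move=> fu; elim=> //= k IHk x /IHk ux; apply: fu; exists (iter k f x).
Qed.

Lemma periodic_orbit_at p z : periodic_orbit f p -> p z ->
  (exists2 k, (0 < k)%N & iter k f z = z) /\ p = range (fun i => iter i f z).
Proof.
move=> [x [k [k0 fk ->]]] [i _ <-]; split.
  by exists k => //; rewrite -iterD addnC iterD fk.
have fkm m : iter (k * m) f x = x.
  by elim: m => [|m IHm]; rewrite ?muln0 // mulnS iterD IHm.
apply/seteqP; split=> [_ [j _ <-]|_ [j _ <-]] /=.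
  (* The extra [k * i - i] steps complete the first [i] ones to a multiple of the period. *)
  exists (j + (k * i - i))%N => //.
  rewrite -iterD -addnA subnK ?leq_pmull // iterD fkm //.
by exists (j + i)%N => //; rewrite iterD.
Qed.

Lemma orbit_of_periodic k z : (0 < k)%N -> iter k f z = z ->
  periodic_orbit f (range (fun i => iter i f z)).
Proof. by move=> k0 fk; exists z, k. Qed.

Lemma iter_muln k z m : iter k f z = z -> iter (m * k) f z = z.
Proof. by move=> fk; elim: m => // m IHm; rewrite mulSn iterD IHm. Qed.

Lemma periodic_orbit_iter p k x : periodic_orbit f p -> p x -> p (iter k f x).
Proof. by move=> pp /(periodic_orbit_at pp) [_ ->]; exists k. Qed.

Lemma periodic_orbit_surj p k x : periodic_orbit f p -> p x ->
  exists2 y, p y & iter k f y = x.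
Proof.
move=> pp px; have [[m m0 fm] _] := periodic_orbit_at pp px.
exists (iter (k * m - k) f x); first exact: periodic_orbit_iter.
by rewrite -iterD subnKC ?leq_pmulr // iter_muln.
Qed.

Lemma attracted_periodic u p k x :
  attracted_by f u p -> u x -> (0 < k)%N -> iter k f x = x -> p x.
Proof.
move=> [_ fu _ <-] ux k0 fk n _; exists (iter (n * k - n) f x).
  exact: stable_iter.
by rewrite -iterD subnKC ?leq_pmulr // iter_muln.
Qed.

Lemma iter_image_sub u m n : stable f u -> (m <= n)%N ->
  iter n f @` u `<=` iter m f @` u.
Proof.
move=> fu mn _ [x ux <-]; exists (iter (n - m) f x); first exact: stable_iter.
by rewrite -iterD subnKC.
Qed.

(** The images of [u] are compact and decrease to [p], so one of them already lies in [O]. *)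
Lemma attracted_eventually u p O : attracted_by f u p -> open O -> p `<=` O ->
  exists N, forall x k, u x -> (N <= k)%N -> O (iter k f x).
Proof.
move=> [[_ clu] fu pu up] oO pO.
have clk k : closed (iter k f @` u).
  apply: compact_closed => //; apply: continuous_compact.
    by apply: continuous_subspaceT => x; exact: iter_continuous.
  exact: (subclosed_compact clu cX).
suff : \forall k \near \oo, forall y, (iter k f @` u) y -> O y.
  move=> [N _ hN]; exists N => x k ux Nk; apply: (hN k) => //=.
  by exists x.
apply: near_compact => // y.
have [Oy|nOy] := pselect (O y).
  exists (O, setT) => /=.
    by split; [exact: open_nbhs_nbhs|exact: filterT].
  by move=> [y' k] /= [].
have /existsNP[n] : ~ forall n, (iter n f @` u) y.
  by move=> h; apply: nOy; apply: pO; rewrite -up => n _.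
move=> nfy; exists (~` (iter n f @` u), [set k | (n <= k)%N]) => /=.
  split; last by exists n.
  by apply: open_nbhs_nbhs; split=> //; exact: closed_openC.
by move=> [y' k] /= [ny' nk] /(iter_image_sub fu nk).
Qed.

(** Given one attracted set [a], attraction becomes a pointwise condition, which passes to unions.
    Compactness makes the entry time into [a] uniform, so late images of [u] lie in images of
    [a]. *)
Lemma attracted_byP a p u : periodic_orbit f p -> attracted_by f a p ->
  attracted_by f u p <->
  [/\ clopen u, stable f u, p `<=` u &
    forall x, u x -> exists k, a (iter k f x)].
Proof.
move=> pp ap; have [[oa cla] fa pa aE] := ap.
split=> [up|[cu fu pu ua]].
  have [cu fu pu uE] := up; split=> // x ux.
  have [N hN] := attracted_eventually up oa pa; exists N; exact: hN.
split=> //; apply/seteqP; split=> [x xu|x px n _]; last first.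
  by have [y /pu uy <-] := periodic_orbit_surj n pp px; exists y.
have [N _ hN] : \forall k \near \oo, forall y, u y -> a (iter k f y).
  apply: near_compact => // y; have [uy|nuy] := pselect (u y); last first.
    exists (~` u, setT) => /=; last by move=> [y' k] /= [].
    split; last exact: filterT.
    by apply: open_nbhs_nbhs; split=> //; apply: closed_openC; case: cu.
  have [n an] := ua y uy.
  exists (iter n f @^-1` a, [set k | (n <= k)%N]) => /=.
    split; last by exists n.
    apply: (@iter_continuous n y a).
    by apply: open_nbhs_nbhs.
  move=> [y' k] /= [any' nk] _; rewrite -(subnK nk) iterD.
  exact: stable_iter.
rewrite -aE => n _; have [y uy <-] := xu (n + N)%N I.
by rewrite iterD; exists (iter N f y) => //; exact: (hN N (leqnn N)).
Qed.

(** If [p] meets [b], its periodic points there belong to [q]. Otherwise the orbit of [y] ends up in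
    the complement of [b], against stability. *)
Lemma attracted_orbit_unique a b p q y : periodic_orbit f p ->
  periodic_orbit f q -> attracted_by f a p -> attracted_by f b q ->
  a y -> b y -> p = q.
Proof.
move=> pp qq ap bq ay bby; have [[ob clb] fb qb _] := bq.
have [[z [pz bz]]|pb] := pselect (exists z, p z /\ b z).
  have [[k k0 fk] ->] := periodic_orbit_at pp pz.
  by have [_ <-] := periodic_orbit_at qq (attracted_periodic bq bz k0 fk).
have [|N hN] := attracted_eventually ap (closed_openC clb).
  by move=> z pz bz; apply: pb; exists z.
by have := hN y N ay (leqnn N); case; exact: stable_iter.
Qed.

End attraction.

(** * Points absorbed by small periodic orbits *)

Section basins.
Context {X : topologicalType} (f : X -> X).
Hypotheses (cX : compact [set: X]) (hX : hausdorff_space X)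
  (zX : zero_dimensional X) (cf : continuous f).
Implicit Types (p q u : set X) (n : nat).
Local Open Scope card_scope.

Lemma fine_separates (x y : X) : x <> y ->
  \forall g \near fine_maps, g x <> g y.
Proof.
move=> /eqP /zX[U [/clopen_loc_const lU Ux nUy]].
by apply: filterS (fine_maps_finer lU) => g gU /gU Uxy; rewrite -Uxy in nUy.
Qed.

Lemma card_orbit_le k n z : (0 < k <= n)%N -> iter k f z = z ->
  range (fun i => iter i f z) #<= `I_n.
Proof.
move=> /andP[k0 kn] fk; apply: (@card_le_trans _ _ _ `I_k).
  have -> : range (fun i => iter i f z) = (fun i => iter i f z) @` `I_k.
    apply/seteqP; split=> [_ [i _ <-]|_ [i _ <-]]; last by exists i.
    exists (i %% k)%N; first by rewrite /= ltn_mod.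
    by rewrite [in RHS](divn_eq i k) addnC iterD iter_muln.
  exact: card_image_le.
by rewrite card_le_II.
Qed.

(** Pigeonhole on the first [n.+1] iterates; by periodicity a coincidence between two of them is
    carried back to [z]. *)
Lemma small_orbit_return p n z : periodic_orbit f p -> p #<= `I_n -> p z ->
  exists2 i, (i < n)%N & iter i.+1 f z = z.
Proof.
move=> pp pn pz; apply: contrapT => nret.
have [[k k0 fk] pE] := periodic_orbit_at pp pz.
have inj : {in `I_n.+1 &, injective (fun i => iter i f z)}.
  have lt_neq i j : (i < j <= n)%N -> iter i f z <> iter j f z.
    move=> /andP[ij jn] fij; apply: nret; exists (j - i).-1.
      by rewrite prednK ?subn_gt0 // (leq_trans (leq_subr _ _)).
    rewrite prednK ?subn_gt0 //.
    have zE : iter (i * k - i) f (iter i f z) = z.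
      by rewrite -iterD subnK ?leq_pmulr // iter_muln.
    rewrite -{1}zE -iterD addnC iterD -(iterD (j - i)) subnK 1?ltnW //.
    by rewrite -fij.
  move=> i j; rewrite !inE /= !ltnS => iN jN fij.
  apply: contrapT => /eqP; rewrite neq_ltn => /orP[ij|ji].
    by apply: (@lt_neq i j) => //; rewrite ij.
  by apply: (@lt_neq j i) => //; rewrite ji.
have : `I_n.+1 #<= `I_n.
  apply: card_le_trans pn.
  apply: (@card_le_trans _ _ _ ((fun i => iter i f z) @` `I_n.+1)).
    by rewrite (card_le_eqr (inj_card_eq inj)).
  by rewrite pE; apply: subset_card_le => _ [i _ <-]; exists i.
by rewrite card_le_II ltnn.
Qed.

Lemma near_not_periodic i (x : X) : iter i f x <> x ->
  \forall y \near x, iter i f y <> y.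
Proof.
move=> /eqP /zX[U [/clopen_loc_const lU Ux nUy]].
near=> y => fy; apply: nUy.
have <- : U y = U x by near: y; exact: lU.
rewrite -fy; have -> // : U (iter i f y) = U (iter i f x).
by near: y; exact: (loc_const_comp lU (iter_continuous cf (n := i))).
Unshelve. all: by end_near. Qed.

(* Once a map separates the points of the orbit, the itinerary of a point which
   stays close to the orbit is determined by its first letter. *)
Lemma attracted_itinerary {T : Type} (h : X -> T) u p x :
  periodic_orbit f p -> attracted_by f u p -> loc_const h -> u x ->
  \forall y \near x, forall i, h (iter i f y) = h (iter i f x).
Proof.
move=> pp up lh ux.
have [g lg [gh gp]] : exists2 g : X -> set X, loc_const g &
    finer g h /\ forall y z, p y -> p z -> g y = g z -> y = z.
  have [z [k [k0 fk pE]]] := pp.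
  apply: fine_maps_ex; near=> g; split.
    by near: g; exact: fine_maps_finer.
  have gz : forall i, (i < k)%N -> forall j, (j < k)%N ->
      iter i f z <> iter j f z -> g (iter i f z) <> g (iter j f z).
    near: g; apply: near_ltn => i ik; apply: near_ltn => j jk.
    have [->|ij] := pselect (iter i f z = iter j f z); first exact: nearW.
    by apply: filterS (fine_separates ij).
  have pz y : p y -> exists2 i, (i < k)%N & iter i f z = y.
    rewrite pE => -[i _ <-]; exists (i %% k)%N; first by rewrite ltn_mod.
    by rewrite [in RHS](divn_eq i k) addnC iterD iter_muln.
  move=> _ _ /pz[i ik <-] /pz[j jk <-] gij.
  by apply: contrapT => /(gz _ ik _ jk).
(* Two successive letters are recorded so that, as [g] separates [p], the orbit point shadowing
   [f y] must be [f z]. *)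
pose O := [set y | exists2 z, p z & g y = g z /\ g (f y) = g (f z)].
have oO : open O.
  rewrite openE => y [z pz [gyz gfyz]]; rewrite /interior /=; near=> y'.
  exists z => //; rewrite -gyz -gfyz; split; near: y'; first exact: lg.
  exact: (loc_const_comp lg cf).
have [|N hN] := attracted_eventually cX hX cf up oO.
  by move=> y py; exists y.
have det w z : u w -> p z -> g (iter N f w) = g z ->
    forall i, g (iter (i + N) f w) = g (iter i f z).
  move=> uw pz gwz; elim=> // i IHi.
  have [z' pz' [gz' gfz']] := hN w (i + N)%N uw (leq_addl _ _).
  rewrite addSn !iterS gfz'; congr (g (f _)); apply: gp => //.
    exact: periodic_orbit_iter.
  by rewrite -gz'.
have [z pz [gxz _]] := hN x N ux (leqnn N).
have [[ou _] _ _ _] := up.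
near=> y.
have uy : u y by near: y; exact: open_nbhs_nbhs.
have gy : forall i, (i < N.+1)%N -> g (iter i f y) = g (iter i f x).
  near: y; apply: near_ltn => i _.
  exact: (loc_const_comp lg (iter_continuous cf (n := i))).
move=> i; apply: gh; have [/gy//|Ni] := ltnP i N.+1.
rewrite -(subnK (ltnW Ni)) (det _ z) // ?(det _ z) //.
by rewrite gy.
Unshelve. all: by end_near. Qed.

(** When [h] resolves [n], this is the union of the attracted part of the partition into fibres
    ([attracted_part_fibre]); [attracted_points] is its analogue independent of any partition. *)
Definition absorbed {T : Type} (h : X -> T) n : set X :=
  [set x | exists p u, [/\ periodic_orbit f p, p #<= `I_n, attracted_by f u p,
    saturated h u & u x]].

Definition attracted_points n : set X :=
  [set x | exists p u k, [/\ periodic_orbit f p, p #<= `I_n,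
    attracted_by f u p & u (iter k f x)]].

Definition resolves {T : Type} (h : X -> T) n :=
  forall p, periodic_orbit f p -> p #<= `I_n ->
    exists2 u, saturated h u & attracted_by f u p.

Lemma card_le_I p m n : (m <= n)%N -> p #<= `I_m -> p #<= `I_n.
Proof. by move=> mn /card_le_trans; apply; rewrite card_le_II. Qed.

Lemma attracted_points_near {T : Type} (h : X -> T) n x :
  attracted_points n x -> loc_const h ->
  \forall y \near x, forall i, h (iter i f y) = h (iter i f x).
Proof.
move=> [p [u [k [pp pn up ufx]]]] lh.
have := iter_continuous cf (attracted_itinerary pp up lh ufx).
rewrite /nbhs /= => hk; near=> y => i; have [ik|ki] := ltnP i k.
  move: i ik; near: y; apply: near_ltn => i _.
  exact: (loc_const_comp lh (iter_continuous cf (n := i))).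
rewrite -(subnK ki) !iterD; move: (i - k)%N; near: y; exact: hk.
Unshelve. all: by end_near. Qed.

Lemma attracted_points_open n : open (attracted_points n).
Proof.
rewrite openE => x [p [u [k [pp pn up ufx]]]]; rewrite /interior /=.
have [[ou _] _ _ _] := up; near=> y; exists p, u, k; split=> //; near: y.
by apply: (iter_continuous cf (n := k) (x := x)); exact: open_nbhs_nbhs.
Unshelve. all: by end_near. Qed.

Lemma attracted_points_le m n : (m <= n)%N ->
  attracted_points m `<=` attracted_points n.
Proof.
move=> mn x [p [u [k [pp pm up ufx]]]]; exists p, u, k; split=> //.
exact: card_le_I pm.
Qed.

Lemma absorbed_attracted {T : Type} (h : X -> T) n :
  absorbed h n `<=` attracted_points n.
Proof. by move=> x [p [u [pp pn up _ ux]]]; exists p, u, 0%N. Qed.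

Lemma attracted_points_iter n k x :
  attracted_points n (iter k f x) -> attracted_points n x.
Proof.
move=> [p [u [l [pp pn up ufx]]]]; exists p, u, (l + k)%N; split=> //.
by rewrite iterD.
Qed.

Lemma absorbed_iter {T : Type} (h : X -> T) n k x :
  absorbed h n x -> absorbed h n (iter k f x).
Proof.
move=> [p [u [pp pn up hu ux]]]; exists p, u; split=> //.
by case: up => _ fu _ _; exact: stable_iter.
Qed.

Lemma absorbed_saturated {T : Type} (h : X -> T) n : saturated h (absorbed h n).
Proof.
move=> x y hxy [p [u [pp pn up hu ux]]]; exists p, u; split=> //.
exact: hu hxy ux.
Qed.

Lemma absorbed_finer {S T : Type} (g : X -> S) (h : X -> T) m n :
  finer g h -> (m <= n)%N -> absorbed h m `<=` absorbed g n.
Proof.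
move=> gh mn x [p [u [pp pm up hu ux]]]; exists p, u; split=> //.
  exact: card_le_I pm.
exact: finer_saturated hu.
Qed.

Lemma resolves_finer {S T : Type} (g : X -> S) (h : X -> T) n :
  finer g h -> resolves h n -> resolves g n.
Proof.
move=> gh hn p pp /(hn p pp) [u hu up]; exists u => //.
exact: finer_saturated hu.
Qed.

Lemma absorbed_hit {T : Type} (h : X -> T) n x : resolves h n ->
  attracted_points n x -> exists k, absorbed h n (iter k f x).
Proof.
move=> hn [p [u [k [pp pn up ufx]]]]; have [v hv vp] := hn p pp pn.
have [/(_ up) [_ _ _ uv] _] := attracted_byP cX hX cf u pp vp.
have [l vfx] := uv _ ufx; exists (l + k)%N, p, v; split=> //.
by rewrite iterD.
Qed.

Lemma absorbed_small_period {T : Type} (h : X -> T) n k x : resolves h n ->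
  (0 < k <= n)%N -> iter k f x = x -> absorbed h n x.
Proof.
move=> hn kn fk; have /andP[k0 _] := kn.
have pp := orbit_of_periodic k0 fk; have pn := card_orbit_le kn fk.
have [u hu up] := hn _ pp pn; exists (range (fun i => iter i f x)), u.
by split=> //; case: up => _ _ pu _; apply: pu; exists 0%N.
Qed.

Lemma absorbed_periodic {T : Type} (h : X -> T) n k x : resolves h n ->
  attracted_points n x -> (0 < k)%N -> iter k f x = x -> absorbed h n x.
Proof.
move=> hn /(absorbed_hit hn) [l] + k0 fk.
move=> /(absorbed_iter (l * k - l)).
by rewrite -iterD subnK ?leq_pmulr // iter_muln.
Qed.

(** The union of all saturated attracted sets works: saturation makes it clopen, and the criterion
    [attracted_byP] is pointwise. *)
Lemma resolves_max {T : Type} (h : X -> T) n p : loc_const h -> resolves h n ->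
  periodic_orbit f p -> p #<= `I_n ->
  exists D, [/\ saturated h D, attracted_by f D p &
    forall u, saturated h u -> attracted_by f u p -> u `<=` D].
Proof.
move=> lh hn pp pn; have [a ha ap] := hn p pp pn.
pose D := [set x | exists u, [/\ saturated h u, attracted_by f u p & u x]].
have hD : saturated h D.
  move=> x y hxy [u [hu up ux]]; exists u; split=> //; exact: hu hxy ux.
exists D; split=> //; last by move=> u hu up x ux; exists u.
apply/(attracted_byP cX hX cf D pp ap); split.
- exact: saturated_clopen hD.
- move=> _ [x [u [hu up ux]] <-]; exists u; split=> //.
  by case: up => _ fu _ _; apply: fu; exists x.
- by move=> x px; exists a; split=> //; case: ap => _ _ pa _; exact: pa.
- by move=> x [u [hu /(attracted_byP cX hX cf u pp ap) [_ _ _ ua] /ua]].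
Qed.

(** A non-divergent cell leading into an attracted set can be added to that set. *)
Lemma absorbed_preimage {T : Type} (h : X -> T) n x : loc_const h ->
  (forall y, h y = h x -> h (f y) = h (f x)) ->
  absorbed h n (f x) -> absorbed h n x.
Proof.
move=> lh hx [p [u [pp pn up hu ufx]]].
have ufy y : h y = h x -> u (f y) by move=> /hx hyx; exact: hu (esym hyx) ufx.
have hv : saturated h (u `|` fibre h x).
  by apply: saturatedU => // y z; rewrite /fibre /= => ->.
exists p, (u `|` fibre h x); split=> //; last by right.
have [_ fu pu _] := up.
apply/(attracted_byP cX hX cf _ pp up); split.
- exact: saturated_clopen hv.
- move=> _ [y [uy|/ufy ?] <-]; left => //; by apply: fu; exists y.
- by move=> y /pu; left.
- by move=> y [uy|/ufy ?]; [exists 0%N|exists 1%N].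
Qed.

(** Local argument: a set attracted by [p] meets no other periodic orbit, and near a point that lies
    on no small orbit there is no point of a small orbit. *)
Lemma fine_resolves n : purely_attracting f ->
  \forall h \near fine_maps, resolves h n.
Proof.
move=> pa.
have : \forall h \near @fine_maps X, forall x, forall p, periodic_orbit f p ->
    p #<= `I_n -> p x -> exists2 u, saturated h u & attracted_by f u p.
  apply: near_compact => // x.
  have [[p [pp pn px]]|np] :=
      pselect (exists p, [/\ periodic_orbit f p, p #<= `I_n & p x]).
    have [u up] := pa p pp; have [cu _ pu _] := up.
    exists (u, [set g | finer g u]) => /=.
      split; last by apply: fine_maps_finer; apply/clopen_loc_const.
      by apply: open_nbhs_nbhs; split; [case: cu|exact: pu].
    move=> [x' g] /= [ux' /saturated_finer gu] q qq qn qx'; exists u => //.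
    have [[k k0 fk] qE] := periodic_orbit_at qq qx'.
    have [_ pE] := periodic_orbit_at pp (attracted_periodic up ux' k0 fk).
    by rewrite qE -pE.
  exists ([set x' | forall i, (i < n)%N -> iter i.+1 f x' <> x'], setT) => /=.
    split; last exact: filterT.
    apply: near_ltn => i iN; apply: (@near_not_periodic i.+1) => fi; apply: np.
    exists (range (fun i => iter i f x)); split.
    - exact: orbit_of_periodic fi.
    - exact: card_orbit_le fi.
    - by exists 0%N.
  move=> [x' g] /= [nx' _] p pp pn px'.
  by have [i /nx'] := small_orbit_return pp pn px'.
apply: filterS => h hx p pp pn; have [z [k [_ _ pE]]] := pp.
by apply: (hx z) => //; rewrite pE; exists 0%N.
Qed.

End basins.

(** * Hitting times *)

Section hitting_times.
Context {X : topologicalType} (f : X -> X).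
Hypothesis cf : continuous f.
Implicit Types C : set X.

Definition hits C x := exists k, C (iter k f x).

(** The value is meaningful only under [hits C x]. *)
Definition hit_time C x : nat :=
  get [set k | C (iter k f x) /\ forall j, (j < k)%N -> ~ C (iter j f x)].

Lemma hit_timeP C x : hits C x ->
  C (iter (hit_time C x) f x) /\
  forall j, (j < hit_time C x)%N -> ~ C (iter j f x).
Proof.
move=> hx; apply: (@getPex _ [set k | C (iter k f x) /\ _]).
have ex : exists k, `[< C (iter k f x) >] by case: hx => k /asboolP; exists k.
case: (ex_minnP ex) => k /asboolP Ck kmin; exists k; split=> // j jk /asboolP.
by move=> /kmin; rewrite leqNgt jk.
Qed.

Lemma hit_time_le C x k : C (iter k f x) -> (hit_time C x <= k)%N.
Proof.
move=> Ck; have [|_ hmin] := @hit_timeP C x; first by exists k.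
by rewrite leqNgt; apply/negP => /hmin.
Qed.

Lemma hit_time_eq C x k : C (iter k f x) ->
  (forall j, (j < k)%N -> ~ C (iter j f x)) -> hit_time C x = k.
Proof.
move=> Ck kmin; apply/eqP; rewrite eqn_leq hit_time_le //= leqNgt.
apply/negP => /kmin; apply.
by have [|] := @hit_timeP C x; first by exists k.
Qed.

Lemma hit_time_step C x : hits C (f x) -> ~ C x ->
  hit_time C x = (hit_time C (f x)).+1.
Proof.
move=> /hit_timeP[Ck kmin] nCx; apply: hit_time_eq; first by rewrite iterSr.
by case=> // j; rewrite ltnS iterSr; exact: kmin.
Qed.

Lemma hit_time_loc_const C : loc_const C -> (forall x, hits C x) ->
  loc_const (hit_time C).
Proof.
move=> lC hC x; have [Ck kmin] := hit_timeP (hC x).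
near=> y; have yx : forall i, (i < (hit_time C x).+1)%N ->
    C (iter i f y) = C (iter i f x).
  near: y; apply: near_ltn => i _.
  exact: (loc_const_comp lC (iter_continuous cf (n := i))).
apply: hit_time_eq; first by rewrite yx.
by move=> j jk; rewrite yx ?ltnS 1?ltnW //; exact: kmin.
Unshelve. all: by end_near. Qed.

End hitting_times.

(** * Refinement by itineraries *)

Section itineraries.
Context {X : topologicalType} (f : X -> X).
Hypotheses (cX : compact [set: X]) (hX : hausdorff_space X)
  (zX : zero_dimensional X) (cf : continuous f).
Context {T : Type} (h : X -> T).
Implicit Types (M : set X) (x y : X).

(* The points with the same h-itinerary as x up to and including the first
   visit to M, or forever if M is never visited. *)
Definition itin M x : set X :=
  [set y | forall i, (forall j, (j < i)%N -> ~ M (iter j f x)) ->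
    h (iter i f y) = h (iter i f x)].

(** Since [M] is saturated, its first visit can be read off the itinerary. Hence the relation is
    symmetric, and [itin M] is the class map of an equivalence relation ([itinE]). *)
Lemma itin_avoid M x y i : saturated h M -> itin M x y ->
  (forall j, (j < i)%N -> ~ M (iter j f x)) <->
  (forall j, (j < i)%N -> ~ M (iter j f y)).
Proof.
move=> hM xy; split=> [nx j ji|ny].
  have /xy e : forall l, (l < j)%N -> ~ M (iter l f x).
    by move=> l lj; apply: nx; exact: ltn_trans ji.
  by move=> /(hM _ _ e); exact: nx.
elim/ltn_ind => j IHj ji; have /xy e : forall l, (l < j)%N -> ~ M (iter l f x).
  by move=> l lj; apply: IHj => //; exact: ltn_trans ji.
by move=> /(hM _ _ (esym e)); exact: ny.
Qed.

Lemma itinE M x y : saturated h M -> itin M x = itin M y <-> itin M y x.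
Proof.
move=> hM; split=> [<-|yx]; first by move=> i _.
apply/seteqP; split=> z zz i ni.
  by rewrite zz ?yx //; apply/(itin_avoid i hM yx).
have /(itin_avoid i hM yx) ny := ni.
by rewrite (zz _ ny) yx.
Qed.

Lemma itin_finer M : saturated h M -> finer (itin M) h.
Proof. by move=> hM x y /(itinE _ _ hM) /(_ 0%N); apply. Qed.

(** Outside [M] the itinerary of [f x] is the tail of that of [x]: this is what makes the cells
    outside [M] non-divergent. *)
Lemma itin_step M x y : saturated h M -> ~ M x ->
  itin M y = itin M x -> itin M (f y) = itin M (f x).
Proof.
move=> hM nMx /(itinE _ _ hM) xy; apply/(itinE _ _ hM) => i ni.
rewrite -!iterSr; apply: xy => -[//|j]; rewrite ltnS iterSr; exact: ni.
Qed.

(** Near an attracted point the whole infinite itinerary is locally constant; elsewhere a visit to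
    [M] leaves finitely many letters to control. *)
Lemma itin_loc_const M n : loc_const h -> saturated h M ->
  (forall x, attracted_points f n x \/ hits f M x) -> loc_const (itin M).
Proof.
move=> lh hM cover x; have [xn|[k Mk]] := cover x.
  apply: filterS (attracted_points_near cX hX zX cf xn lh) => y yx.
  by apply/(itinE _ _ hM) => i _.
near=> y; apply/(itinE _ _ hM) => i ni.
have ik : (i < k.+1)%N by rewrite ltnS leqNgt; apply/negP => /ni.
move: i ik {ni}; near: y; apply: near_ltn => i _.
exact: (loc_const_comp lh (iter_continuous cf (n := i))).
Unshelve. all: by end_near. Qed.

(* If the cells outside M are not divergent, a cell outside the absorbed set
   cannot lead into it without first visiting M; hence refining by the
   itineraries up to M minus the absorbed set only cuts absorbed cells, and
   the absorbed set does not grow. *)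
Lemma absorbed_itin M n : loc_const h -> resolves f h n -> saturated h M ->
  (forall x y, ~ M x -> h y = h x -> h (f y) = h (f x)) ->
  absorbed f (itin (M `\` absorbed f h n)) n `<=` absorbed f h n.
Proof.
move=> lh hn hM det; set A := absorbed f h n; set N := M `\` A.
have hA : saturated h A by exact: absorbed_saturated.
have hN : saturated h N by apply: saturatedI => //; exact: saturatedC.
(* Until it visits [N], an orbit starting outside [A] also avoids [M], so its cells are not
   divergent and [absorbed_preimage] forbids entering [A]. *)
have same x y : ~ A x -> h y = h x -> itin N y = itin N x.
  move=> nAx yx; apply/(itinE _ _ hN).
  suff step i : (forall j, (j < i)%N -> ~ N (iter j f x)) ->
      ~ A (iter i f x) /\ h (iter i f y) = h (iter i f x).
    by move=> i /step [].
  elim: i => // i IHi ni.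
  have [|nAi ei] := IHi; first by move=> j ji; apply: ni; exact: ltnW.
  have nMi : ~ M (iter i f x) by move=> Mi; exact: (ni i (ltnSn i)).
  split; last by rewrite !iterS; exact: det.
  rewrite iterS => /(absorbed_preimage cX hX cf lh) Ai; apply: nAi.
  by apply: Ai => z; exact: det.
move=> x [p [u [pp pn up hu ux]]]; apply: contrapT => nAx.
have [D [hD Dp Dmax]] := resolves_max cX hX cf lh hn pp pn.
(* A point of [u] in [A] is absorbed by [p] itself, the attracting orbit being unique, so it lies in
   the largest set [D]; outside [A], [same] applies. *)
have hDu : saturated h (D `|` u).
  move=> y z yz [Dy|uy]; first by left; exact: hD yz Dy.
  have [[q [v [qq qn vq hv vy]]]|nAy] := pselect (A y).
    left; apply: hD yz _; apply: (Dmax v) => //.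
    by rewrite (attracted_orbit_unique cX hX cf pp qq up vq uy vy).
  by right; apply: hu uy; apply/esym; apply: same => //.
apply: nAx; exists p, (D `|` u); split=> //; last by right.
apply/(attracted_byP cX hX cf _ pp Dp); have [_ fD pD _] := Dp; split.
- exact: saturated_clopen hDu.
- have [_ fu _ _] := up.
  by move=> _ [y [Dy|uy] <-]; [left; apply: fD|right; apply: fu]; exists y.
- by move=> y /pD; left.
- move=> y [Dy|]; first by exists 0%N.
  by have [/(_ up) [_ _ _ uD] _] := attracted_byP cX hX cf u pp Dp; exact: uD.
Qed.

End itineraries.

(** * Marked partitions into fibres *)

Section cells.
Context {X : topologicalType} (f : X -> X).
Hypotheses (cX : compact [set: X]) (hX : hausdorff_space X)
  (zX : zero_dimensional X) (cf : continuous f).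
Context {T : Type} (h : X -> T).
Hypothesis lh : loc_const h.
Implicit Types (u M P : set X) (n : nat).
Local Open Scope card_scope.

Definition cells : set (set X) := range (fibre h).

Lemma saturated_union (A : set (set X)) : A `<=` cells -> saturated h (union A).
Proof.
move=> Ah x y hxy [u Au ux]; exists u => //=; move: ux.
by have [z _ <-] := Ah u Au; rewrite /fibre /= hxy.
Qed.

Lemma union_fibre u : saturated h u -> union (fibre h @` u) = u.
Proof.
move=> hu; apply/seteqP; split=> [y [_ [x ux <-]] xy|x ux].
  exact: hu (esym xy) ux.
by exists (fibre h x) => //; exists x.
Qed.

Lemma cells_partition : clopen_partition cells.
Proof.
have hc x : clopen (fibre h x).
  by apply: (saturated_clopen lh) => y z; rewrite /fibre /= => ->.
split; last by move=> _ [x _ <-].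
(* Finiteness by compactness: along the filter of collections containing a prescribed finite one,
   each cell is eventually included, uniformly over its points. *)
- pose F := filter_from (@finite_set (set X)) (fun A => [set B | A `<=` B]).
  have FF : Filter F.
    apply: filter_from_filter; first by exists set0; exact: finite_set0.
    move=> A B fA fB; exists (A `|` B); first by rewrite finite_setU.
    by move=> D /= ABD; split=> u /= ?; apply: ABD; [left|right].
  have [A fA AF] : \forall A \near F, forall x, A (fibre h x).
    apply: near_compact => // x.
    exists (fibre h x, [set A | [set fibre h x] `<=` A]) => /=.
      split; last by exists [set fibre h x]; [exact: finite_set1|].
      by apply: open_nbhs_nbhs; split=> //; case: (hc x).
    by move=> [y A] /= [/(fibreE h y x) -> Ax]; exact: Ax.
  by apply: sub_finite_set fA => _ [x _ <-]; exact: AF.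
- split.
  + by apply/seteqP; split=> // x _; exists (fibre h x) => //; exists x.
  + move=> _ _ [x _ <-] [y _ <-] [z [xz yz]]; apply/fibreE.
    by rewrite -xz -yz.
  + by move=> _ [x _ <-]; exists x.
Qed.

Lemma basin_spec n p : resolves f h n -> periodic_orbit f p ->
  p #<= `I_n ->
  [/\ basin f cells p `<=` cells, attracted_by f (union (basin f cells p)) p &
    forall B, B `<=` cells -> attracted_by f (union B) p ->
      B `<=` basin f cells p].
Proof.
move=> hn pp pn; have [D [hD Dp Dmax]] := resolves_max cX hX cf lh hn pp pn.
rewrite /basin; set S := [set A | _]; apply: (@getPex _ S).
exists (fibre h @` D); split.
- by move=> _ [x _ <-]; exists x.
- by rewrite union_fibre.
- move=> B Bh Bp u Bu; have [x _ xu] := Bh u Bu; exists x => //.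
  apply: (Dmax (union B)) => //; first exact: saturated_union.
  by exists u => //; rewrite -xu.
Qed.

Lemma attracted_part_fibre n x : resolves f h n ->
  attracted_part f cells n (fibre h x) <-> absorbed f h n x.
Proof.
move=> hn; split=> [[p [pp pn] bx]|[p [u [pp pn up hu ux]]]].
  have [Bh Bp _] := basin_spec hn pp pn.
  exists p, (union (basin f cells p)); split=> //.
    exact: saturated_union.
  by exists (fibre h x).
exists p => //; have [_ _ Bmax] := basin_spec hn pp pn.
apply: (Bmax (fibre h @` u)); last by exists x.
  by move=> _ [y _ <-]; exists y.
by rewrite union_fibre.
Qed.

Lemma cells_supercyclical n : (0 < n)%N -> resolves f h n ->
  supercyclical f cells n.
Proof.
move=> n0 hn; split=> //; first exact: cells_partition.
move=> p pp pn; have [u hu up] := hn p pp pn; exists (fibre h @` u).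
  by move=> _ [y _ <-]; exists y.
by rewrite union_fibre.
Qed.

(** The attracted part takes precedence: cells of [M] or [P] inside it get the mark 0. *)
Definition marking n M P (u : set X) : mark :=
  if `[< attracted_part f cells n u >] then Defs.mzero
  else if `[< u `<=` M >] then mstar
  else if `[< u `<=` P >] then Defs.mup else mdown.

Lemma saturated_fibre_sub M x : saturated h M -> fibre h x `<=` M <-> M x.
Proof.
by move=> hM; split=> [xM|Mx y xy]; [exact: xM|exact: hM (esym xy) Mx].
Qed.

Lemma marking_fibre n M P x : resolves f h n ->
  saturated h M -> saturated h P ->
  marking n M P (fibre h x) =
  if `[< absorbed f h n x >] then Defs.mzero
  else if `[< M x >] then mstar else if `[< P x >] then Defs.mup else mdown.
Proof.
move=> hn hM hP; rewrite /marking.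
rewrite (asbool_equiv_eq (attracted_part_fibre x hn)).
rewrite (asbool_equiv_eq (saturated_fibre_sub x hM)).
by rewrite (asbool_equiv_eq (saturated_fibre_sub x hP)).
Qed.

(* Outside E the hitting time of E is constant on cells and decreases strictly
   along the edges. *)
Lemma cycle_hits (E : set X) C : (forall x, hits f E x) ->
  finer h (hit_time f E) -> directed_cycle (graph f cells) C ->
  exists2 x, cycle_vertices C (fibre h x) & E x.
Proof.
move=> hE fE [c [c0 cc CE]].
have vC u : u \in c -> cycle_vertices C u.
  move=> uc; have : u \in unzip1 (zip c (rot 1 c)).
    by rewrite unzip1_zip ?size_rot.
  by case/mapP => e ec ->; exists e => //; rewrite CE.
apply: contrapT => none.
(* Descent along the cycle: if none of its cells meets [E], each next cell has a smaller hitting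
   time. *)
have desc m x : fibre h x \in c -> (hit_time f E x <= m)%N -> False.
  elim: m x => [|m IHm] x xc.
    rewrite leqn0 => /eqP hx0; apply: none; exists x; first exact: vC.
    by have [] := hit_timeP (hE x); rewrite hx0.
  have := next_cycle cc xc => /asboolP [_ [y _ yE]] /= [x' xx' yx'] hxm.
  move: yE yx' => /= yE; rewrite -yE => yx'.
  apply: (IHm y); first by rewrite yE mem_next.
  rewrite -(fE _ _ yx') -ltnS -hit_time_step //.
    by rewrite (fE _ _ xx').
  move=> Ex'; apply: none; exists x' => //; rewrite (fibreE h x' x).2 //.
  exact: vC.
case: c c0 cc CE vC desc => // u c _ cc CE vC desc.
have [e [[[x _ xu] _ _] eu]] : exists e, (graph f cells) e /\ e.1 = u.
  have /(next_cycle cc)/asboolP := mem_head u c.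
  by exists (u, next (u :: c) u).
apply: (desc _ x _ (leqnn _)).
by rewrite xu eu mem_head.
Qed.

(** [E] and [F] stand for [M] and [P] modulo the absorbed set: a cell of the supercyclical part that
    meets [E] has to lie in [M], and likewise for [F] and [P]. *)
Lemma marking_well_marked n M P (E F : set X) : (0 < n)%N ->
  resolves f h n -> saturated h M -> saturated h P -> M `&` P = set0 ->
  (forall x, hits f E x) -> finer h (hit_time f E) ->
  E `<=` M `|` absorbed f h n ->
  (forall x, hits f F x) -> finer h (hit_time f F) ->
  F `<=` P `|` absorbed f h n ->
  well_marked f cells n (marking n M P).
Proof.
move=> n0 hn hM hP MP hE fE EM hF fF FP; split.
- exact: cells_supercyclical.
- by move=> u /asboolP ua; rewrite /marking ua.
- move=> u [_ nua]; rewrite /marking asboolF //.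
  by case: asboolP => // _; case: asboolP.
- move=> C [cC _] Csup.
  have out x : cycle_vertices C (fibre h x) ->
      ~ absorbed f h n x /\ cells (fibre h x).
    by move=> /Csup [xU nx]; split=> // /(attracted_part_fibre x hn).
  have [x xC /EM Mx] := cycle_hits hE fE cC.
  have [y yC /FP Py] := cycle_hits hF fF cC.
  have [nx xU] := out x xC; have [ny yU] := out y yC.
  split; [exists (fibre h x) => //|exists (fibre h y) => //]; split=> //.
    rewrite marking_fibre // asboolF // asboolT //; by case: Mx.
  rewrite marking_fibre // asboolF // asboolF ?asboolT //; first by case: Py.
  by move=> My; have : set0 y by rewrite -MP; split=> //; case: Py.
Qed.

Lemma cells_divergent x : divergent (graph f cells) (fibre h x) ->
  exists2 y, h y = h x & h (f y) <> h (f x).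
Proof.
move=> [v [w [[_ [y _ yv] /= [x1 xx1 yx1]] [_ [z _ zw] /= [x2 xx2 zx2]] vw]]].
apply: contrapT => det; apply: vw.
move: yv zw yx1 zx2 => /= yv zw; rewrite -yv -zw => yx1 zx2.
apply/fibreE.
have e t : h t = h x -> h (f t) = h (f x).
  by move=> tx; apply: contrapT => ne; apply: det; exists t.
by rewrite -yx1 -zx2 !e.
Qed.

Lemma marking_divergent n M P u : resolves f h n ->
  saturated h M -> saturated h P ->
  (forall x y, ~ (M x /\ ~ absorbed f h n x) ->
    h y = h x -> h (f y) = h (f x)) ->
  cells u -> divergent (graph f cells) u -> marker cells (marking n M P) u.
Proof.
move=> hn hM hP det uU; have [x _ <-] := uU => /cells_divergent [y yx nyx].
have [Mx nx] : M x /\ ~ absorbed f h n x.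
  by apply: contrapT => /det /(_ yx).
split; first by exists x.
by rewrite marking_fibre // asboolF // asboolT.
Qed.

Lemma parent_fibre {S : Type} (g : X -> S) x : finer g h ->
  parent cells (fibre g x) = fibre h x.
Proof.
move=> gh; rewrite /parent; set Q := [set u | _].
have [|[y _ yE] sub] := @getPex _ Q.
- exists (fibre h x); split; first by exists x.
  by move=> y /gh.
- rewrite -yE; apply/fibreE; apply/esym.
  have : get Q x by apply: sub.
  by rewrite -yE.
Qed.

End cells.

(** * The return map and its colourings *)

Section return_map.
Context {X : topologicalType} (f : X -> X).
Hypotheses (cX : compact [set: X]) (zX : zero_dimensional X)
  (cf : continuous f).
Implicit Types (A P Q : set X).

(** Counting from [f x] makes the return time positive even when [x] is in [Q]. *)
Definition return_map Q x := iter (hit_time f Q (f x)).+1 f x.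

Lemma return_map_in Q x : hits f Q (f x) -> Q (return_map Q x).
Proof. by move=> /hit_timeP[+ _]; rewrite /return_map iterSr. Qed.

Lemma return_map_loc_const {T : Type} Q (c : X -> T) : loc_const Q ->
  (forall x, hits f Q x) -> loc_const c ->
  loc_const (c \o return_map Q).
Proof.
move=> lQ hQ lc x; rewrite /= /return_map.
near=> y.
have -> : hit_time f Q (f y) = hit_time f Q (f x).
  near: y; exact: (loc_const_comp (hit_time_loc_const cf lQ hQ) cf).
near: y; set k := (hit_time f Q (f x)).+1.
exact: (loc_const_comp lc (iter_continuous cf (n := k))).
Unshelve. all: by end_near. Qed.

(** Returns are to the union of [P] and [A], which every orbit will meet. Ascents lie in [P], so new
    marks sit inside the old potentials. *)
Definition ascents P A (c : X -> nat) : set X :=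
  [set x | [/\ P x, ~ A x, ~ A (return_map (P `|` A) x) &
    (c x < c (return_map (P `|` A) x))%N]].

Lemma ascents_loc_const P A c : loc_const P -> loc_const A ->
  (forall x, hits f (P `|` A) x) -> loc_const c ->
  loc_const (ascents P A c).
Proof.
move=> lP lA hQ lc.
have lQ := loc_constU lP lA.
pose r := return_map (P `|` A).
have := loc_const_pair (loc_const_pair lP lA) (loc_const_pair
  (return_map_loc_const lQ hQ lA)
  (loc_const_pair lc (return_map_loc_const lQ hQ lc))).
apply: loc_const_finer => x y [Pxy Axy rAxy cxy rcxy].
by rewrite /ascents /= Pxy Axy cxy; move: rAxy rcxy => /= -> ->.
Qed.

(* Along successive returns which are not ascents the colour decreases. *)
Lemma ascents_hit P A c : (forall x, hits f (P `|` A) x) ->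
  (forall x, P x -> ~ A x -> ~ A (return_map (P `|` A) x) ->
    c x <> c (return_map (P `|` A) x)) ->
  forall x, hits f (ascents P A c `|` A) x.
Proof.
move=> hQ cP.
have hP n x : (c x < n)%N -> P x -> hits f (ascents P A c `|` A) x.
  elim: n x => // n IHn x cxn Px.
  have [Ax|nAx] := pselect (A x); first by exists 0%N; right.
  have rx := return_map_in (hQ (f x)).
  have [Arx|nArx] := pselect (A (return_map (P `|` A) x)).
    by exists (hit_time f (P `|` A) (f x)).+1; right.
  case: (ltngtP (c x) (c (return_map (P `|` A) x))) => [lt|gt|e].
  - by exists 0%N; left.
  - have [|k kr] := IHn _ (leq_trans gt cxn); first by case: rx.
    exists (k + (hit_time f (P `|` A) (f x)).+1)%N.
    by rewrite iterD.
  - by case: (cP x).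
move=> x; have [k [Pk|Ak]] := hQ x; last by exists k; right.
by have [l lk] := hP _ _ (ltnSn _) Pk; exists (l + k)%N; rewrite iterD.
Qed.

Lemma loc_const_nat_bounded (c : X -> nat) : loc_const c ->
  exists N, forall x, (c x <= N)%N.
Proof.
move=> lc; have [N _ hN] : \forall N \near \oo, forall x, (c x <= N)%N.
  apply: near_compact => // x.
  exists ([set y | c y = c x], [set N | (c x <= N)%N]) => /=.
    by split; [exact: lc|exists (c x)].
  by move=> [y N] /= [-> ].
by exists N; exact: (hN N (leqnn N)).
Qed.

(** A clopen set separating a point from its return still separates nearby ones. By compactness one
    partition separates everywhere, and its finitely many cells are numbered. *)
Lemma return_coloring P A : loc_const P -> loc_const A ->
  (forall x, hits f (P `|` A) x) ->
  (forall x, P x -> ~ A x -> return_map (P `|` A) x <> x) ->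
  exists2 c : X -> nat, loc_const c & forall x, P x -> ~ A x ->
    ~ A (return_map (P `|` A) x) -> c x <> c (return_map (P `|` A) x).
Proof.
move=> lP lA hQ nofix.
have lQ := loc_constU lP lA.
have [h lh hr] : exists2 h : X -> set X, loc_const h & forall x, P x -> ~ A x ->
    h x <> h (return_map (P `|` A) x).
  suff : \forall h \near @fine_maps X, forall x, P x -> ~ A x ->
      h x <> h (return_map (P `|` A) x) by move=> /fine_maps_ex.
  apply: near_compact => // x.
  have [[Px nAx]|nPA] := pselect (P x /\ ~ A x); last first.
    exists ([set y | (P y, A y) = (P x, A x)], setT) => /=.
      by split; [exact: loc_const_pair|exact: filterT].
    by move=> [y g] /= [[-> ->] _] Px nAx; case: nPA.
  have /eqP/zX[U [/clopen_loc_const lU Ur nUx]] := nofix x Px nAx.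
  exists ([set y | U y = U x /\ U (return_map (P `|` A) y) =
      U (return_map (P `|` A) x)], [set g | finer g U]) => /=.
    split; last exact: fine_maps_finer.
    near=> y; split; near: y; first exact: lU.
    exact: (return_map_loc_const lQ hQ lU).
  move=> [y g] /= [[Uy Ury] gU] _ _ /gU; rewrite Uy Ury => e.
  by rewrite -e in Ur.
have [fin _ _] := cells_partition cX lh.
have [c cinj] : exists c : set X -> nat, {in cells h &, injective c}.
  exact/countable_injP/finite_set_countable.
exists (c \o fibre h).
  by apply: loc_const_finer (loc_const_fibre lh) => x y /= ->.
move=> x Px nAx _ /= /cinj; rewrite !inE => /(_ _ _)/fibreE e.
by apply: (hr x) => //; apply: e; [exists x|exists (return_map (P `|` A) x)].
Unshelve. all: by end_near. Qed.

End return_map.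

(** * The inductive step *)

Section stages.
Context {X : topologicalType} (f : X -> X).
Hypotheses (cX : compact [set: X]) (hX : hausdorff_space X)
  (zX : zero_dimensional X) (cf : continuous f).

Record stage := Stage {
  stage_map : X -> set X;
  stage_rank : nat;
  stage_markers : set X;
  stage_potentials : set X }.

Definition stage_cells s := cells (stage_map s).

Definition stage_marking s := marking f (stage_map s) (stage_rank s)
  (stage_markers s) (stage_potentials s).

(** The induction invariant. It is kept apart from [marked_stage] so that the initial stage, of rank
    0, can satisfy it without being well-marked. *)
Definition extensible s :=
  [/\ loc_const (stage_map s), loc_const (stage_potentials s) &
    forall x, attracted_points f (stage_rank s) x \/
      hits f (stage_potentials s) x].

Definition marked_stage s :=
  [/\ resolves f (stage_map s) (stage_rank s),
    saturated (stage_map s) (stage_markers s),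
    saturated (stage_map s) (stage_potentials s),
    stage_markers s `&` stage_potentials s = set0 &
    well_marked f (stage_cells s) (stage_rank s) (stage_marking s) /\
    forall u, stage_cells s u -> divergent (graph f (stage_cells s)) u ->
      marker (stage_cells s) (stage_marking s) u].

Definition extends s t :=
  [/\ finer (stage_map t) (stage_map s), (stage_rank s <= stage_rank t)%N &
    stage_markers t `|` stage_potentials t `<=` stage_potentials s].

(** New markers and potentials lie over old potentials, and a down mark is allowed over any nonzero
    mark. The old mark is nonzero because absorbed sets grow under refinement. *)
Lemma extends_relatively_well_marked s t : loc_const (stage_map s) ->
  loc_const (stage_map t) -> marked_stage s -> marked_stage t -> extends s t ->
  relatively_well_marked f (stage_cells t) (stage_rank t) (stage_marking t)
    (stage_cells s) (stage_rank s) (stage_marking s).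
Proof.
move=> ls lt [rs sMs sPs MPs [ws _]] [rt sMt sPt MPt [wt _]] [fts nst MPP].
split=> //.
  move=> _ [x _ <-]; exists (fibre (stage_map s) x); first by exists x.
  by move=> y /fts.
move=> v [[x _ <-] nx]; rewrite /stage_marking /stage_cells parent_fibre //.
rewrite !marking_fibre //.
have nat : ~ absorbed f (stage_map t) (stage_rank t) x.
  by move=> xa; apply: nx; exact/attracted_part_fibre.
have nas : ~ absorbed f (stage_map s) (stage_rank s) x.
  by move=> xa; apply: nat; exact: absorbed_finer nst _ xa.
rewrite (asboolF nat) (asboolF nas).
have MPsx : stage_markers s x -> ~ stage_potentials s x.
  by move=> Mx Px; have : set0 x by rewrite -MPs.
have MPPx := MPP x.
case: asboolP => [Mt|nMt].
  have Ps : stage_potentials s x by apply: MPPx; left.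
  by rewrite asboolF ?asboolT // => /MPsx.
case: asboolP => [Pt|nPt].
  have Ps : stage_potentials s x by apply: MPPx; right.
  by rewrite asboolF ?asboolT // => /MPsx.
by case: asboolP => // _; case: asboolP.
Qed.

Lemma stage_step s k (h0 : X -> set X) : purely_attracting f ->
  loc_const h0 -> extensible s ->
  exists t, [/\ extensible t, marked_stage t, extends s t,
    finer (stage_map t) h0 & (k <= stage_rank t)%N].
Proof.
case: s => h n M P; rewrite /extensible /extends /= => pa lh0 [lh lP hitP].
have [N hN] : exists N, forall x, attracted_points f n x \/
    exists2 i, (i <= N)%N & P (iter i f x).
  have [N _ hN] : \forall N \near \oo, forall x, attracted_points f n x \/
      exists2 i, (i <= N)%N & P (iter i f x).
    apply: near_compact => // x; have [xn|[i Pi]] := hitP x.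
      exists (attracted_points f n, setT) => /=.
        split; last exact: filterT.
        by apply: open_nbhs_nbhs; split=> //; exact: attracted_points_open.
      by move=> [y N] /= [yn _]; left.
    exists ([set y | P (iter i f y) = P (iter i f x)],
      [set N | (i <= N)%N]) => /=.
      split; last by exists i.
      exact: (loc_const_comp lP (iter_continuous cf (n := i))).
    by move=> [y N] /= [Py iN]; right; exists i => //; rewrite Py.
  by exists N; exact: (hN N (leqnn N)).
(* [N.+1] bounds the return time to [P] of points whose image is not attracted. *)
pose m := maxn (maxn n k) N.+1.
have nm : (n <= m)%N by rewrite /m !leq_max leqnn.
have km : (k <= m)%N by rewrite /m !leq_max leqnn orbT.
have Nm : (N < m)%N by rewrite /m !leq_max ltnSn orbT.
have m0 : (0 < m)%N by exact: leq_ltn_trans Nm.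
have [h1 lh1 [[h1h0 h1h] rh1]] : exists2 h1 : X -> set X, loc_const h1 &
    (finer h1 h0 /\ finer h1 h) /\ resolves f h1 m.
  apply: fine_maps_ex; near=> g; split; [split|]; near: g.
  - exact: fine_maps_finer.
  - exact: fine_maps_finer.
  - exact: fine_resolves.
pose A := absorbed f h1 m.
have lA : loc_const A.
  exact/clopen_loc_const/(saturated_clopen lh1)/absorbed_saturated.
have attA x : attracted_points f m x -> hits f A x.
  exact: absorbed_hit.
have hQ x : hits f (P `|` A) x.
  have [/(attracted_points_le nm)/attA [i Ai]|[i Pi]] := hitP x.
    by exists i; right.
  by exists i; left.
(* A fixed point of the return map is periodic; either it is attracted, or its period is at most
   [N.+1]. Both put it in [A]. *)
have nofix x : P x -> ~ A x -> return_map f (P `|` A) x <> x.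
  move=> Px nAx rx; apply: nAx; have [xn|[i iN Pi]] := hN (f x).
    apply: (absorbed_periodic cX hX cf rh1 _ _ rx) => //.
    apply: (attracted_points_iter (k := 1)).
    exact: (attracted_points_le nm xn).
  apply: (absorbed_small_period rh1 _ rx) => /=.
  apply: leq_ltn_trans Nm; apply: leq_trans iN.
  by apply: hit_time_le; left.
have [c lc cP] := return_coloring cX zX cf lP lA hQ nofix.
have [K cK] := loc_const_nat_bounded cX lc.
(* The ascents of [c'] are the descents of [c]; the bound [K] keeps the truncated subtraction
   injective. *)
pose c' x := (K - c x)%N.
have lc' : loc_const c' by apply: loc_const_finer lc => x y e; rewrite /c' e.
pose M1 := ascents f P A c; pose P1 := ascents f P A c'.
have lM1 : loc_const M1 by exact: ascents_loc_const.
have lP1 : loc_const P1 by exact: ascents_loc_const.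
have hE : forall x, hits f (M1 `|` A) x by exact: ascents_hit.
have hF : forall x, hits f (P1 `|` A) x.
  apply: ascents_hit => // x Px nAx nAr e; apply: (cP x) => //.
  by rewrite -(subKn (cK x)) -[in RHS](subKn (cK _)); congr (_ - _)%N.
have MP1 : M1 `&` P1 = set0.
  apply/seteqP; split=> // x [[_ _ _ lt] [_ _ _ gt]]; move: gt.
  by rewrite /c' ltnNge leq_sub2l // ltnW.
have [h2 lh2 [[h2h1 h2M h2P] [h2E h2F]]] : exists2 h2 : X -> set X,
    loc_const h2 & [/\ finer h2 h1, finer h2 M1 & finer h2 P1] /\
    finer h2 (hit_time f (M1 `|` A)) /\
    finer h2 (hit_time f (P1 `|` A)).
  apply: fine_maps_ex; near=> g; split; split; near: g;
    apply: fine_maps_finer => //; apply: hit_time_loc_const => //;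
    exact: loc_constU.
have sM2 : saturated h2 M1 by exact/saturated_finer.
have A_att : A `<=` attracted_points f m by exact: absorbed_attracted.
(* First cut: divergent cells now lie in [M1], possibly inside the absorbed set [B]. *)
pose h3 := itin f h2 M1.
have lh3 : loc_const h3.
  apply: (itin_loc_const (n := m) cX hX zX cf lh2 sM2) => x.
  have [i [Mi|Ai]] := hE x; first by right; exists i.
  by left; apply: attracted_points_iter; exact: A_att Ai.
have h32 : finer h3 h2 by exact: itin_finer.
have sM3 : saturated h3 M1 by exact: finer_saturated sM2.
have rh3 : resolves f h3 m.
  by apply: resolves_finer rh1; exact: finer_trans h2h1.
pose B := absorbed f h3 m.
have sB : saturated h3 (M1 `\` B).
  by apply: saturatedI => //; apply: saturatedC; exact: absorbed_saturated.
(* Second cut: divergence is confined to [M1] outside [B]; [absB] then shows that the absorbed set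
   has not outgrown [B]. *)
pose h4 := itin f h3 (M1 `\` B).
have lh4 : loc_const h4.
  apply: (itin_loc_const (n := m) cX hX zX cf lh3 sB) => x.
  have [i [Mi|Ai]] := hE x; last first.
    by left; apply: attracted_points_iter; exact: A_att Ai.
  have [Bi|nBi] := pselect (B (iter i f x)); last by right; exists i.
  by left; apply: attracted_points_iter; apply: absorbed_attracted Bi.
have h43 : finer h4 h3 by exact: itin_finer.
have h42 : finer h4 h2 by exact: finer_trans h32.
have h41 : finer h4 h1 by exact: finer_trans h2h1.
have absB : absorbed f h4 m `<=` B.
  apply: absorbed_itin => // x y nMx; exact: itin_step.
have rh4 : resolves f h4 m by exact: resolves_finer rh1.
have sM4 : saturated h4 M1 by exact: finer_saturated sM2.
have sP4 : saturated h4 P1.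
  by apply: (finer_saturated h42); exact/saturated_finer.
have A4 : A `<=` absorbed f h4 m by exact: absorbed_finer.
exists (Stage h4 m M1 P1); split=> /=.
- split=> // x; have [i [Pi|Ai]] := hF x; first by right; exists i.
  by left; apply: attracted_points_iter; exact: A_att Ai.
- split=> //=; split.
    apply: (marking_well_marked cX hX cf lh4
      (E := M1 `|` A) (F := P1 `|` A)) => //.
    + exact: finer_trans h2E.
    + by move=> x [|/A4]; [left|right].
    + exact: finer_trans h2F.
    + by move=> x [|/A4]; [left|right].
  move=> u; apply: marking_divergent => // x y nx.
  apply: itin_step => // -[Mx nBx]; apply: nx; split=> //.
  by move=> /absB.
- split=> //; first exact: finer_trans h1h.
  by move=> x [] [].
- exact: finer_trans h1h0.
- exact: km.
Unshelve. all: by end_near. Qed.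

End stages.

(** * Mesh estimates *)

Section metric.
Context {R : realType} {X : metricType R}.
Local Open Scope ring_scope.

Lemma fine_maps_small (e : R) : compact [set: X] -> hausdorff_space X ->
  zero_dimensional X -> 0 < e ->
  \forall h \near @fine_maps X, forall x y, h x = h y -> mdist x y <= e.
Proof.
move=> cX hX zX e0; apply: near_compact => // x.
have e20 : 0 < e / 2 by rewrite divr_gt0.
have [D [Dx cD] Dball] := zero_dimensional_cvg hX zX cX (nbhsx_ballx x _ e20).
exists (D, [set g | finer g D]) => /=.
  split; first by apply: open_nbhs_nbhs; split=> //; case: cD.
  by apply: fine_maps_finer; exact/clopen_loc_const.
move=> [x' g] /= [Dx' gD] y /gD Dxy.
have Dy : D y by rewrite -Dxy.
suff : ball x' e y by rewrite ballEmdist => /ltW.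
by rewrite (splitr e); apply: ball_triangle (Dball _ Dy); exact/ball_sym/Dball.
Qed.

Lemma sup_itv0 (A : set R) (e : R) : 0 <= e ->
  (forall a, A a -> 0 <= a <= e) -> 0 <= sup A <= e.
Proof.
move=> e0 Ae; have [->|/set0P A0] := eqVneq A set0; first by rewrite sup0 lexx.
have ubA : ubound A e by move=> a /Ae /andP[].
have [a Aa] := A0; have /andP[a0 _] := Ae a Aa.
rewrite ge_sup // andbT (le_trans a0) //.
by apply: ub_le_sup => //; exists e.
Qed.

Lemma mesh_le (U : set (set X)) (e : R) : 0 <= e ->
  (forall u, U u -> forall x y, u x -> u y -> mdist x y <= e) ->
  0 <= mesh U <= e.
Proof.
move=> e0 Ue; apply: sup_itv0 => // _ [u Uu <-]; apply: sup_itv0 => //.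
by move=> _ [x ux [y uy <-]]; rewrite mdist_ge0 (Ue u).
Qed.

End metric.

(** * Construction of the sequence *)

Local Open Scope ring_scope.

(* Sequences are indexed by n >= 1: their values at 0 are irrelevant. *)
Theorem theorem3p39 (R : realType) (X : metricType R) (f : X -> X) :
  cantor_system f -> purely_attracting f ->
  exists (U : nat -> set (set X)) (chi : nat -> set X -> mark) (tau : nat -> nat),
    [/\ forall n, (1 <= n)%N -> clopen_partition (U n),
        mesh (U n) @[n --> \oo] --> (0 : R),
        forall n, (1 <= n)%N -> forall u, U n u ->
          u = union [set v | U n.+1 v /\ v `<=` u],
        (forall m n, (1 <= m)%N -> (m <= n)%N -> (tau m <= tau n)%N) /\
        (forall n, (1 <= n)%N -> (n <= tau n)%N) &
        forall n, (1 <= n)%N ->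
          [/\ well_marked f (U n) (tau n) (chi n),
              relatively_well_marked f (U n.+1) (tau n.+1) (chi n.+1)
                (U n) (tau n) (chi n) &
              forall u, U n u -> divergent (graph f (U n)) u ->
                marker (U n) (chi n) u]].
Proof.
move=> [[_ cX hX zX] cf] pa.
have step (ks : nat * {s : stage (X := X) | extensible f s}) :
    exists t : {s : stage (X := X) | extensible f s},
      [/\ marked_stage f (sval t), extends (sval ks.2) (sval t),
        forall x y, stage_map (sval t) x = stage_map (sval t) y ->
          mdist x y <= ks.1.+1%:R^-1 :> R &
        (ks.1 <= stage_rank (sval t))%N].
  case: ks => k [s es] /=.
  have k0 : 0 < k.+1%:R^-1 :> R by rewrite invr_gt0.
  have [h0 lh0 h0k] := fine_maps_ex (fine_maps_small cX hX zX k0).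
  have [t [et mt st th0 kt]] := stage_step cX hX zX cf k pa lh0 es.
  exists (exist _ t et); split=> //= x y /th0; exact: h0k.
have [next nextP] := choice step.
(* Initially there is a single fibre and every point is a potential, so every orbit is hit at time
   0. *)
have es0 : extensible f (Stage (fun=> set0) 0 set0 [set: X]).
  split=> /= [x|x|x]; [exact: nearW|exact: nearW|by right; exists 0%N].
(* The index passed to [next] is that of the stage being built, which gives rank at least [n] at
   stage [n]. *)
pose S := fix S n : {s : stage (X := X) | extensible f s} :=
  if n is m.+1 then next (n, S m) else exist _ _ es0.
pose s n := sval (S n).
have es n : extensible f (s n) by exact: (svalP (S n)).
have ls n : loc_const (stage_map (s n)) by case: (es n).
have sP n : [/\ marked_stage f (s n.+1), extends (s n) (s n.+1),
    forall x y, stage_map (s n.+1) x = stage_map (s n.+1) y ->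
      mdist x y <= n.+2%:R^-1 :> R & (n.+1 <= stage_rank (s n.+1))%N].
  exact: (nextP (n.+1, S n)).
have part n : clopen_partition (stage_cells (s n)) by exact: cells_partition.
have marked n : (1 <= n)%N -> marked_stage f (s n).
  by case: n => // n _; case: (sP n).
exists (fun n => stage_cells (s n)), (fun n => stage_marking f (s n)),
  (fun n => stage_rank (s n)); split.
- by move=> n _.
- rewrite -cvg_shiftS /=.
  apply: (@squeeze_cvgr _ _ _ _ (cst 0) harmonic).
  + near=> n; have [_ _ small _] := sP n.
    have /andP[-> le2] : 0 <= mesh (stage_cells (s n.+1)) <= n.+2%:R^-1.
      apply: mesh_le; first by rewrite invr_ge0.
      by move=> _ [z _ <-] x y /= xz yz; apply: small; rewrite xz yz.
    by rewrite (le_trans le2) // lef_pV2 ?posrE // ler_nat.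
  + exact: cvg_cst.
  + exact: cvg_harmonic.
- move=> n _ _ [x _ <-]; have [_ [fn _ _] _ _] := sP n.
  apply/seteqP; split=> [y yx|y [v [_ vx] vy]]; last exact: vx.
  exists (fibre (stage_map (s n.+1)) y) => //; split; first by exists y.
  by move=> z /fn; rewrite /fibre /= => ->.
- split=> [m n _|]; last by case=> // n _; case: (sP n).
  elim: n => [|n IHn]; first by rewrite leqn0 => /eqP ->.
  rewrite leq_eqVlt => /orP[/eqP -> //|/IHn /leq_trans]; apply.
  by have [_ [_ ? _] _ _] := sP n.
- move=> n n1; have mn := marked n n1; have [_ _ _ _ [wn dn]] := mn.
  have [mn1 en _ _] := sP n.
  by split=> //; exact: extends_relatively_well_marked.
Unshelve. all: by end_near. Qed.
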